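(* Let $\alpha,\beta\in(0,1)$, $c>0$ and $\theta\ge 0$ be fixed. For each integer $N\ge 2$, let $\mu_N^{ss}$ be the unique stationary probability measure on $\Omega_N=\{0,1\}^{I_N}$, $I_N=\{1,\dots,N-1\}$, of the exclusion process with slow boundary with generator $L_N$ (with parameters $\alpha,\beta,c,\theta$). Let $\rho_\theta:[0,1]\to[0,1]$ be defined by $$\rho_\theta(u)=\begin{cases}(\beta-\alpha)u+\alpha & \text{if }\theta<1,\\[2pt] \dfrac{c(\beta-\alpha)}{2+c}\,u+\alpha+\dfrac{\beta-\alpha}{2+c} & \text{if }\theta=1,\\[6pt] \dfrac{\alpha+\beta}{2} & \text{if }\theta>1.\end{cases}$$ Then, for any $\delta>0$ and any continuous function $H:[0,1]\to\mathbb{R}$, $$\lim_{N\to\infty}\mu_N^{ss}\left(\eta:\left|\frac{1}{N-1}\sum_{x\in I_N}H(x/N)\,\eta(x)-\int_0^1H(u)\rho_\theta(u)\,du\right|\ge\delta\right)=0.$$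
   Context: For $N\ge2$, $I_N=\{1,\dots,N-1\}$ and $\Omega_N=\{0,1\}^{I_N}$, with elements (configurations) $\eta=\{\eta(x):x\in I_N\}$. For $\eta\in\Omega_N$ and $x,y\in I_N$, $\eta^{x,y}$ is the configuration obtained from $\eta$ by exchanging the values $\eta(x)$ and $\eta(y)$, and $\eta^x$ is the configuration obtained from $\eta$ by replacing $\eta(x)$ with $1-\eta(x)$. The exclusion process with slow boundary is the continuous-time Markov process on the finite set $\Omega_N$ with generator $L_N=L_{N,0}+L_{N,b}^\alpha+L_{N,b}^\beta$, acting on functions $f:\Omega_N\to\mathbb{R}$ by $$L_{N,0}f(\eta)=\sum_{x=1}^{N-2}[f(\eta^{x,x+1})-f(\eta)],$$ $$L_{N,b}^\alpha f(\eta)=cN^{-\theta}r_\alpha(\eta)[f(\eta^1)-f(\eta)],\qquad L_{N,b}^\beta f(\eta)=cN^{-\theta}r_\beta(\eta)[f(\eta^{N-1})-f(\eta)],$$ where $r_\alpha(\eta)=\alpha[1-\eta(1)]+(1-\alpha)\eta(1)$ and $r_\beta(\eta)=\beta[1-\eta(N-1)]+(1-\beta)\eta(N-1)$. This process is irreducible, so it has a unique stationary (invariant) probability measure, denoted $\mu_N^{ss}$. *)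

(* Defs.v *)
From HB Require Import structures.
From mathcomp Require Import all_boot all_order all_fingroup all_algebra.
From mathcomp Require Import all_classical all_reals all_analysis.
Set Implicit Arguments.
Unset Strict Implicit.
Unset Printing Implicit Defensive.
Import Order.TTheory GRing.Theory Num.Theory.
Import numFieldNormedType.Exports.
Local Open Scope classical_set_scope.
Local Open Scope ring_scope.

(* The condition N >= 2 is encoded by writing N = n.+2.  The site x of
   I_N = {1, ..., N-1} is represented by the ordinal i : 'I_n.+1 with
   x = i.+1: the boundary sites 1 and N-1 are ord0 and ord_max. *)
Definition config (n : nat) := {ffun 'I_n.+1 -> bool}.

HB.instance Definition _ (n : nat) := Finite.on (config n).
HB.instance Definition _ (n : nat) := isPointed.Build (config n) [ffun=> false].
HB.instance Definition _ (n : nat) :=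
  @isMeasurable.Build default_measure_display (config n)
    discrete_measurable discrete_measurable0
    discrete_measurableC discrete_measurableU.

Definition exchange n (eta : config n) (x y : 'I_n.+1) : config n :=
  [ffun z => eta (tperm x y z)].

Definition flip n (eta : config n) (x : 'I_n.+1) : config n :=
  [ffun z => if z == x then ~~ eta z else eta z].

Definition occ (R : realType) n (eta : config n) (x : 'I_n.+1) : R :=
  (eta x)%:R.

Section generator.
Variables (R : realType) (n : nat).
Implicit Types (f : config n -> R) (eta : config n).

(* widen_ord (leqnSn n) x and lift ord0 x, for x : 'I_n, are the elements of
   'I_n.+1 with values x and x.+1, i.e., neighbouring sites. *)
Definition bulk_generator f eta : R :=
  \sum_(x < n)
    (f (exchange eta (widen_ord (leqnSn n) x) (lift ord0 x)) - f eta).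

Definition reservoir_rate (a : R) eta (x : 'I_n.+1) : R :=
  a * (1 - occ R eta x) + (1 - a) * occ R eta x.

Definition boundary_generator (a c theta : R) (x : 'I_n.+1) f eta : R :=
  c * n.+2%:R `^ (- theta) * reservoir_rate a eta x * (f (flip eta x) - f eta).

Definition generator (alpha beta c theta : R) f eta : R :=
  bulk_generator f eta
  + boundary_generator alpha c theta ord0 f eta
  + boundary_generator beta c theta ord_max f eta.

(* The transition semigroup exp(t L) of the Markov process with generator L;
   the exponential series converges because config n is finite. *)
Definition semigroup (L : (config n -> R) -> config n -> R) (t : R) f eta : R :=
  limn (series (fun k => exp_coeff t k * iter k L f eta)).

Definition stationary (alpha beta c theta : R) (mu : probability (config n) R) :=
  forall (t : R) f, 0 <= t ->
    ('E_mu[semigroup (generator alpha beta c theta) t f] = 'E_mu[f])%E.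

End generator.

Definition rho (R : realType) (alpha beta c theta : R) (u : R) : R :=
  if theta < 1 then (beta - alpha) * u + alpha
  else if theta == 1 then
    c * (beta - alpha) / (2 + c) * u + alpha + (beta - alpha) / (2 + c)
  else (alpha + beta) / 2.

Definition empirical_average (R : realType) n (H : R -> R) (eta : config n) : R :=
  (n.+1%:R)^-1 * \sum_(x < n.+1) H (x.+1%:R / n.+2%:R) * occ R eta x.

(* Main.v *)
Require Import Defs.
From mathcomp Require Import all_boot all_order all_fingroup all_algebra.
From mathcomp Require Import all_classical all_reals all_analysis.
From mathcomp Require Import ring lra.
Set Implicit Arguments.
Unset Strict Implicit.
Unset Printing Implicit Defensive.
Import Order.TTheory GRing.Theory Num.Theory.
Import numFieldNormedType.Exports.
Local Open Scope classical_set_scope.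
Local Open Scope ring_scope.

(* Let r be the discrete stationary profile, affine in the site, and let
   F_g(eta) = sum_x g(x) (eta(x) - r(x)).  Then L F_g = - D(g, eta - r), where D
   is the Dirichlet form with boundary terms, and the carre du champ of F_g is
   at most D(g, g).  Stationarity applied to F_g^2 therefore gives
   2 E[F_g D(g, eta - r)] <= D(g, g) for every g.  Taking for g a maximizer of
   E[F_g^2] on the unit sphere, an eigenvector of the second-moment matrix, this
   Lyapunov inequality yields E[F_g^2] <= |g|^2 / 2 for all g.  With
   g(x) = H(x/N) / (N-1) the bound is O(1/N), so Chebyshev's inequality reduces
   the theorem to the convergence of the Riemann sums of H against r. *)

(** * Riemann sums *)

Lemma uniform_continuity_itv (R : realType) (a b : R) (G : R -> R) :
  {within `[a, b], continuous G} ->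
  forall e, 0 < e -> exists2 d, 0 < d &
    forall x y, x \in `[a, b] -> y \in `[a, b] ->
      `|x - y| < d -> `|G x - G y| < e.
Proof.
move=> /subspace_continuousP Gc e e0.
have /compact_near_coveringP cov := @segment_compact R a b.
pose P (d : R) (x : R) := x \in `[a, b] -> forall y, y \in `[a, b] ->
   `|x - y| < d -> `|G x - G y| < e.
have : \forall d \near 0^'+, `[a, b] `<=` P d.
  apply: cov => x xab.
  have e20 : 0 < e / 2 by rewrite divr_gt0.
  have /cvgrPdist_lt/(_ _ e20) := Gc x xab.
  rewrite near_withinE => -[d /= d0 dP].
  have d20 : 0 < d / 2 by rewrite divr_gt0.
  exists ([set y | `|x - y| < d / 2], [set t | 0 < t < d / 2]).
    split=> /=.
      exists (d / 2) => //.
    by near=> t; apply/andP; split; near: t; [exact: nbhs_right_gt|exact: nbhs_right_lt].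
  move=> [y t] /= [xy /andP[t0 td]] yab z zab yz.
  have xz : `|x - z| < d.
    by rewrite -(subrKA y) (le_lt_trans (ler_normD _ _))// (splitr d) ltrD// (lt_trans yz).
  have xy' : `|x - y| < d by rewrite (lt_trans xy)// ltr_pdivrMr// ltr_pMr// ltr1n.
  have h1 := dP y xy' yab.
  have h2 := dP z xz zab.
  rewrite -(subrKA (G x)) (le_lt_trans (ler_normD _ _))// (splitr e) ltrD//.
  by rewrite distrC.
move=> [d /= d0 dP]; exists (d / 2); first by rewrite divr_gt0.
move=> x y xab yab; apply: (dP (d / 2)) => //=.
  by rewrite sub0r normrN gtr0_norm ?divr_gt0// ltr_pdivrMr// ltr_pMr// ltr1n.
by rewrite divr_gt0.
Unshelve. all: by end_near. Qed.

Lemma Rintegral_oc_approx (R : realType) (G : R -> R) (a b v e : R) :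
  a <= b -> {within `[a, b], continuous G} ->
  (forall x, x \in `]a, b] -> `|G x - v| <= e) ->
  `|\int[lebesgue_measure]_(x in `]a, b]) G x - v * (b - a)| <= e * (b - a).
Proof.
move=> ab Gc Gv.
have ic (K : R -> R) : {within `[a, b], continuous K} ->
    lebesgue_measure.-integrable `]a, b] (EFin \o K).
  move=> Kc; have := continuous_compact_integrable (@segment_compact R a b) Kc.
  by apply: integrableS => //; apply: subset_itvr; rewrite bnd_simp.
have iG := ic _ Gc.
have icst (k : R) : lebesgue_measure.-integrable `]a, b] (EFin \o cst k).
  by apply: (ic (cst k)); apply: continuous_subspaceT => x; exact: cst_continuous.
have int (k : R) : \int[lebesgue_measure]_(x in `]a, b]) (cst k) x = k * (b - a).
  rewrite Rintegral_cst//; congr (_ * _).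
  by rewrite [X in fine X]lebesgue_measure_itv /= lte_fin; case: ltgtP ab => // ->; rewrite subrr.
have lo : (v - e) * (b - a) <= \int[lebesgue_measure]_(x in `]a, b]) G x.
  rewrite -int; apply: le_Rintegral => //= x xab.
  by have := Gv x xab; rewrite ler_norml => /andP[? ?]; lra.
have hi : \int[lebesgue_measure]_(x in `]a, b]) G x <= (v + e) * (b - a).
  rewrite -int; apply: le_Rintegral => //= x xab.
  by have := Gv x xab; rewrite ler_norml => /andP[? ?]; lra.
move: lo hi; set J := \int[_]_(x in _) _; clearbody J; clear => lo hi.
by rewrite ler_norml; apply/andP; split; lra.
Qed.

Lemma Riemann_sum_cvg (R : realType) (G : R -> R) :
  {within `[0, 1], continuous G} ->
  (fun n => n.+1%:R^-1 * \sum_(i < n.+1) G (i.+1%:R / n.+1%:R)) @ \oo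
    --> \int[lebesgue_measure]_(x in `[0, 1]) G x.
Proof.
move=> Gc; apply/cvgrPdist_le => e e0.
have [d d0 dP] := uniform_continuity_itv Gc e0.
near=> n.
have n0 : 0 < n.+1%:R :> R by rewrite ltr0Sn.
pose t (k : nat) : R := k%:R / n.+1%:R.
have tS k : t k.+1 - t k = n.+1%:R^-1.
  by rewrite /t -mulrBl -natr1 addrAC subrr add0r mul1r.
have t0 : t 0 = 0 by rewrite /t mul0r.
have t1 : t n.+1 = 1 by rewrite /t divff// gt_eqF.
have tmono k l : (k <= l)%N -> t k <= t l.
  by move=> kl; rewrite /t ler_pM2r ?invr_gt0// ler_nat.
have tge0 k : 0 <= t k by rewrite -t0 tmono.
have tle1 k : (k <= n.+1)%N -> t k <= 1 by rewrite -t1; exact: tmono.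
pose F (k : nat) := \int[lebesgue_measure]_(x in `[0, t k]) G x.
have Gc' k : (k <= n.+1)%N -> {within `[0, t k], continuous G}.
  move=> kn; apply: continuous_subspaceW Gc; apply: subset_itvl.
  by rewrite bnd_simp tle1.
have -> : \int[lebesgue_measure]_(x in `[0, 1]) G x = \sum_(i < n.+1) (F i.+1 - F i).
  rewrite -(big_mkord xpredT (fun i => F i.+1 - F i)) telescope_sumr//.
  by rewrite /F t1 t0 set_itv1 Rintegral_set1 subr0.
rewrite mulr_sumr -sumrB (le_trans (ler_norm_sum _ _ _))//.
rewrite (@le_trans _ _ (\sum_(i < n.+1) (e * n.+1%:R^-1)))//; last first.
  by rewrite sumr_const card_ord -[leLHS]mulr_natr -mulrA mulVf ?mulr1// gt_eqF.
apply: ler_sum => i _.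
rewrite [F _ - _]Rintegral_itvB; last 3 first.
- apply: continuous_compact_integrable; first exact: segment_compact.
  exact: Gc'.
- by rewrite bnd_simp; exact: tge0.
- by rewrite bnd_simp; exact: tmono.
rewrite [_ * G _]mulrC -/(t i.+1) -(tS i).
apply: Rintegral_oc_approx; first exact: tmono.
  apply: continuous_subspaceW Gc => x /=; rewrite !in_itv /= => /andP[xi xi1].
  by rewrite (le_trans _ xi)// (le_trans xi1)// tle1.
move=> x; rewrite in_itv /= => /andP[xi xi1].
apply/ltW/dP.
- by rewrite in_itv /= (le_trans _ (ltW xi))//= (le_trans xi1)// tle1.
- by rewrite in_itv /=; apply/andP; split; [exact: tge0|exact: tle1].
- rewrite distrC ger0_norm ?subr_ge0//.
  rewrite (@le_lt_trans _ _ n.+1%:R^-1)//; first by rewrite -(tS i) lerB// ltW.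
  near: n; exact: near_infty_natSinv_lt (PosNum d0).
Unshelve. all: by end_near. Qed.

(* The empirical average has [n.+1] terms and mesh [n.+2]: the missing node is [1]. *)
Lemma Riemann_sum_interior_cvg (R : realType) (G : R -> R) :
  {within `[0, 1], continuous G} ->
  (fun n => n.+1%:R^-1 * \sum_(i < n.+1) G (i.+1%:R / n.+2%:R)) @ \oo
    --> \int[lebesgue_measure]_(x in `[0, 1]) G x.
Proof.
move=> Gc; set I := (X in _ --> X).
have h : (fun n : nat => n.+1%:R^-1 : R) @ \oo --> (0 : R).
  exact: (@cvg_harmonic R).
pose S n := n.+2%:R^-1 * \sum_(i < n.+2) G (i.+1%:R / n.+2%:R).
have SI : S @ \oo --> I.
  have := Riemann_sum_cvg Gc; rewrite -cvg_shiftS; exact.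
have : (fun n : nat => S n + n.+1%:R^-1 * (S n - G 1)) @ \oo --> I + 0 * (I - G 1).
  by apply: cvgD => //; apply: cvgM => //; apply: cvgB => //; exact: cvg_cst.
rewrite mul0r addr0; apply: cvg_trans; apply: near_eq_cvg; near=> n.
rewrite /S big_ord_recr /=.
rewrite divff ?pnatr_eq0//.
set s := \sum_(i < _) _; rewrite -[n.+2%:R]natr1.
by field; rewrite nat1r natr1 !pnatr_eq0.
Unshelve. all: by end_near. Qed.

(** * Stationarity and the generator *)

Definition weight (R : realType) n (mu : probability (config n) R) (eta : config n) : R :=
  fine (mu [set eta]).

Lemma weight_ge0 (R : realType) n (mu : probability (config n) R) eta : 0 <= weight mu eta.
Proof. by rewrite fine_ge0. Qed.

Lemma expectation_weight (R : realType) n (mu : probability (config n) R) (f : config n -> R) :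
  'E_mu[f]%E = (\sum_eta weight mu eta * f eta)%:E.
Proof.
have mA (A : set (config n)) : measurable A by [].
rewrite unlock.
have ind eta : mu.-integrable setT (fun x => (\1_[set eta] x)%:E).
  by apply: integrable_indic => //; rewrite setIT; exact: fin_num_fun_lty.
under eq_integral => x _.
  have -> : (f x)%:E = (\sum_eta (f eta)%:E * (\1_[set eta] x)%:E)%E.
    rewrite (bigD1 x)//= indicE mem_set// mule1 big1 ?adde0// => y yx.
    rewrite indicE memNset ?mule0//= => xy; by rewrite xy eqxx in yx.
  over.
rewrite integral_sum//; last by move=> eta; apply: integrableZl.
rewrite -sumEFin; apply: eq_bigr => eta _.
rewrite integralZl// integral_indic// setIT /weight mulrC EFinM fineK//.
exact: fin_num_measure.
Qed.

Lemma measure_weight (R : realType) n (mu : probability (config n) R) (A : set (config n)) :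
  mu A = (\sum_eta weight mu eta * \1_A eta)%:E.
Proof. by rewrite -expectation_weight expectation_indic. Qed.

Lemma exp_coeff_le_sqr (R : realType) (x : R) k : 0 <= x <= 1 -> (2 <= k)%N ->
  exp_coeff x k <= x ^+ 2 * exp_coeff 1 k.
Proof.
move=> /andP[x0 x1] k2; rewrite /exp_coeff /= expr1n mulrA mulr1 ler_pM2r ?invr_gt0 ?ltr0n ?fact_gt0//.
exact: ler_wiXn2l.
Qed.

Section semigroup_derivative.
Variables (R : realType) (n : nat) (L : (config n -> R) -> config n -> R) (C : R).
Hypothesis C_ge0 : 0 <= C.
Hypothesis L_bounded : forall f (M : R), (forall eta, `|f eta| <= M) ->
  forall eta, `|L f eta| <= C * M.

Lemma iter_bounded f (M : R) k : (forall eta, `|f eta| <= M) ->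
  forall eta, `|iter k L f eta| <= C ^+ k * M.
Proof.
move=> fM; elim: k => [|k IH] eta; first by rewrite expr0 mul1r.
by rewrite iterS exprS -mulrA; apply: L_bounded.
Qed.

Lemma semigroup_first_order f (M t : R) eta : (forall eta, `|f eta| <= M) ->
  0 <= t -> t * C <= 1 ->
  `|semigroup L t f eta - f eta - t * L f eta| <= M * expR 1 * C ^+ 2 * t ^+ 2.
Proof.
move=> fM t0 tC.
have M0 : 0 <= M by apply: le_trans (fM eta).
pose u k := exp_coeff t k * iter k L f eta.
have uM k : `|u k| <= M * exp_coeff (t * C) k.
  rewrite normrM ger0_norm ?exp_coeff_ge0//.
  apply: (@le_trans _ _ (exp_coeff t k * (C ^+ k * M))).
    by rewrite ler_wpM2l ?exp_coeff_ge0// iter_bounded.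
  by rewrite /exp_coeff /= exprMn le_eqVlt; apply/orP; left; apply/eqP; ring.
have cu : cvgn (series u).
  apply: normed_cvg; apply: (@series_le_cvg _ _ (fun k => M * exp_coeff (t * C) k)).
  - by move=> k; exact: normr_ge0.
  - by move=> k; apply: mulr_ge0 => //; apply: exp_coeff_ge0; apply: mulr_ge0.
  - exact: uM.
  - have := @is_cvg_series_exp_coeff R (t * C).
    by exact: is_cvg_seriesZ.
have partial k : `|series u k.+2 - (f eta + t * L f eta)| <= M * expR 1 * C ^+ 2 * t ^+ 2.
  have -> : series u k.+2 - (f eta + t * L f eta) = \sum_(2 <= i < k.+2) u i.
    rewrite /series /= (@big_cat_nat _ _ _ 2)//= [X in X + _ - _]big_nat_recr//= big_nat1.
    by rewrite {1 2}/u /exp_coeff /= expr0 expr1 (factS 0) fact0 muln1 !divr1 mul1r; ring.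
  apply: le_trans (ler_norm_sum _ _ _) _.
  apply: (@le_trans _ _ (\sum_(2 <= i < k.+2) M * ((t * C) ^+ 2 * exp_coeff 1 i))).
    apply: ler_sum_nat => i /andP[i2 _]; apply: le_trans (uM i) _.
    by rewrite ler_wpM2l// exp_coeff_le_sqr// mulr_ge0//=.
  rewrite -mulr_sumr -mulr_sumr exprMn.
  rewrite (_ : M * expR 1 * C ^+ 2 * t ^+ 2 = M * (t ^+ 2 * C ^+ 2 * expR 1)); last by ring.
  rewrite ler_wpM2l// ler_wpM2l ?mulr_ge0 ?sqr_ge0//.
  apply: (@le_trans _ _ (series (exp_coeff 1) k.+2)).
    rewrite /series /= [leRHS](@big_cat_nat _ _ _ 2)//= lerDr sumr_ge0// => i _.
    exact: exp_coeff_ge0.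
  apply: nondecreasing_cvgn_le; last exact: is_cvg_series_exp_coeff.
  by apply: nondecreasing_series => i _ _; exact: exp_coeff_ge0.
rewrite -addrA -opprD.
have : (fun k => `|series u k - (f eta + t * L f eta)|) @ \oo -->
    `|semigroup L t f eta - (f eta + t * L f eta)|.
  by apply: cvg_norm; apply: cvgB; [exact: cu|exact: cvg_cst].
move=> /cvgr_to_le; by apply; exists 2 => // -[|[|k]]//= _.
Qed.

Lemma stationary_generator (mu : probability (config n) R) (f : config n -> R) :
  (forall t : R, 0 <= t -> ('E_mu[semigroup L t f] = 'E_mu[f])%E) ->
  \sum_eta weight mu eta * L f eta = 0.
Proof.
move=> st.
pose M := \sum_eta `|f eta|.
have fM eta : `|f eta| <= M by rewrite /M (bigD1 eta)//= lerDl sumr_ge0.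
pose B := M * expR 1 * C ^+ 2 * \sum_eta weight mu eta.
have B0 : 0 <= B.
  by rewrite !mulr_ge0 ?sumr_ge0 ?expR_ge0 ?sqr_ge0// => eta _; rewrite weight_ge0.
have key t : 0 < t -> t * C <= 1 -> `|\sum_eta weight mu eta * L f eta| <= B * t.
  move=> t0 tC.
  have := st t (ltW t0); rewrite !expectation_weight => -[E].
  rewrite -(ler_pM2l t0) -[X in X * `|_|](gtr0_norm t0) -normrM.
  rewrite (_ : t * _ = - \sum_eta weight mu eta *
      (semigroup L t f eta - f eta - t * L f eta)); last first.
    under [in RHS]eq_bigr do rewrite !mulrBr.
    rewrite !sumrB E subrr sub0r opprK mulr_sumr.
    by apply: eq_bigr => eta _; ring.
  rewrite normrN (le_trans (ler_norm_sum _ _ _))//.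
  rewrite (_ : t * (B * t) = \sum_eta weight mu eta * (M * expR 1 * C ^+ 2 * t ^+ 2)); last first.
    by rewrite -mulr_suml /B; ring.
  apply: ler_sum => eta _; rewrite normrM ger0_norm ?weight_ge0//.
  by rewrite ler_wpM2l ?weight_ge0// semigroup_first_order// ltW.
apply/eqP; rewrite -normr_le0; apply/ler_addgt0Pr => e e0; rewrite add0r.
have C1 : 0 < 1 + C by rewrite ltr_pwDl.
have B1 : 0 < 1 + B by rewrite ltr_pwDl.
pose t := Num.min (1 + C)^-1 (e / (1 + B)).
have t0 : 0 < t by rewrite lt_min invr_gt0 C1 divr_gt0.
apply: le_trans (key t t0 _) _.
  apply: (@le_trans _ _ ((1 + C)^-1 * C)); first by rewrite ler_wpM2r// ge_min lexx.
  by rewrite mulrC ler_pdivrMr// mul1r lerDr.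
apply: (@le_trans _ _ (B * (e / (1 + B)))).
  by rewrite ler_wpM2l// ge_min lexx orbT.
by rewrite mulrCA ger_pMr// ler_pdivrMr// mul1r lerDr.
Qed.

End semigroup_derivative.

Lemma generator_bounded (R : realType) n (alpha beta c theta : R) :
  exists2 C, 0 <= C & forall (f : config n -> R) (M : R), (forall eta, `|f eta| <= M) ->
    forall eta, `|generator alpha beta c theta f eta| <= C * M.
Proof.
pose k := c * n.+2%:R `^ (- theta).
pose C eta : R := \sum_(x < n) 2 + `|k * reservoir_rate alpha eta (ord0 : 'I_n.+1)| * 2
  + `|k * reservoir_rate beta eta (ord_max : 'I_n.+1)| * 2.
have C0 eta : 0 <= C eta by rewrite !addr_ge0// ?sumr_ge0// => *; rewrite mulr_ge0.
exists (\sum_eta C eta); first by rewrite sumr_ge0.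
move=> f M fM eta.
have M0 : 0 <= M by apply: le_trans (fM eta).
apply: (@le_trans _ _ (C eta * M)); last first.
  by rewrite ler_wpM2r// (bigD1 eta)//= lerDl sumr_ge0.
have df x : `|f x - f eta| <= 2 * M.
  by rewrite (le_trans (ler_normB _ _))// mulr_natl mulr2n lerD.
rewrite /generator /C !mulrDl.
apply: le_trans (ler_normD _ _) _; apply: lerD; last first.
  by rewrite /boundary_generator normrM -[leRHS]mulrA ler_wpM2l.
apply: le_trans (ler_normD _ _) _; apply: lerD; last first.
  by rewrite /boundary_generator normrM -[leRHS]mulrA ler_wpM2l.
by rewrite mulr_suml (le_trans (ler_norm_sum _ _ _))// ler_sum.
Qed.

Lemma stationary_mean_generator (R : realType) n (alpha beta c theta : R)
    (mu : probability (config n) R) f :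
  stationary alpha beta c theta mu ->
  \sum_eta weight mu eta * generator alpha beta c theta f eta = 0.
Proof.
move=> st; have [C C0 Cb] := generator_bounded n alpha beta c theta.
by apply: (stationary_generator C0 Cb) => t; exact: st.
Qed.

(** * A Lyapunov comparison *)

Definition dotr (R : realType) m (g h : 'rV[R]_m) : R := \sum_i g 0 i * h 0 i.

Lemma dotrDl (R : realType) m (g h k : 'rV[R]_m) :
  dotr (g + h) k = dotr g k + dotr h k.
Proof. by rewrite -big_split; apply: eq_bigr => i _; rewrite !mxE mulrDl. Qed.

Lemma dotrZl (R : realType) m a (g k : 'rV[R]_m) : dotr (a *: g) k = a * dotr g k.
Proof. by rewrite /dotr mulr_sumr; apply: eq_bigr => i _; rewrite !mxE mulrA. Qed.

Lemma dotrC (R : realType) m (g h : 'rV[R]_m) : dotr g h = dotr h g.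
Proof. by apply: eq_bigr => i _; rewrite mulrC. Qed.

Lemma dotr_ge0 (R : realType) m (g : 'rV[R]_m) : 0 <= dotr g g.
Proof. by apply: sumr_ge0 => i _; rewrite -expr2 sqr_ge0. Qed.

Lemma dotr_gt0 (R : realType) m (g : 'rV[R]_m) : (0 < dotr g g) = (g != 0).
Proof.
rewrite lt_neqAle dotr_ge0 andbT eq_sym; congr negb; apply/eqP/eqP => [|->]; last first.
  by apply: big1 => i _; rewrite mxE mul0r.
move=> g0; apply/rowP => i; rewrite mxE.
have /(_ i isT)/eqP := psumr_eq0P (fun i _ => sqr_ge0 (g 0 i)) g0.
by rewrite mulf_eq0 orbb => /eqP.
Qed.

Lemma dotr_continuous (R : realType) m (v : 'rV[R]_m) :
  continuous (fun g : 'rV[R]_m => dotr g v).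
Proof.
rewrite /dotr; apply: continuous_big => [|i _ g].
  exact: add_continuous.
by apply: continuousM; [exact: coord_continuous|exact: cst_continuous].
Qed.

Lemma dotr_diag_continuous (R : realType) m :
  continuous (fun g : 'rV[R]_m => dotr g g).
Proof.
rewrite /dotr; apply: continuous_big => [|i _ g].
  exact: add_continuous.
by apply: continuousM; exact: coord_continuous.
Qed.

Lemma sphere_compact (R : realType) m : compact [set g : 'rV[R]_m | dotr g g = 1].
Proof.
apply: (@subclosed_compact _ _ [set v : 'rV[R]_m | forall i, v 0 i \in `[-1, 1]]).
- have := preimage_closed (fun g _ => @dotr_diag_continuous R m g) (@closed_eq R 1).
  exact.
- have : compact [set v : 'rV[R]_m | forall i, `[-1, 1]%classic (v ord0 i)].
    apply: (@rV_compact R _ (fun=> `[-1, 1]%classic)) => _.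
    exact: segment_compact.
  by congr compact; apply/seteqP; split => v /=.
- move=> g /= g1 i; rewrite in_itv /= -ler_norml.
  rewrite -(@expr_le1 _ 2)// real_normK ?num_real// -g1 /dotr (bigD1 i)//= lerDl sumr_ge0// => j _.
  by rewrite -expr2 sqr_ge0.
Qed.

Lemma quadratic_le0_linear_eq0 (R : realFieldType) (x y : R) :
  (forall e, e * x + e ^+ 2 * y <= 0) -> x = 0.
Proof.
move=> /(_ (x / (1 + `|y|))); set a := 1 + `|y|.
have a0 : 0 < a by rewrite ltr_pwDl.
have ay : 0 < a + y by have := ler_norm (- y); rewrite normrN /a; lra.
have -> : x / a * x + (x / a) ^+ 2 * y = x ^+ 2 * ((a + y) / a ^+ 2).
  by field; rewrite gt_eqF.
rewrite pmulr_lle0 ?divr_gt0 ?exprn_gt0// => x0.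
by apply/eqP; rewrite -sqrf_eq0 eq_le x0 sqr_ge0.
Qed.

Lemma Lyapunov_comparison (R : realType) (I : finType) m (w : I -> R)
    (v : I -> 'rV[R]_m) (K : 'rV[R]_m -> 'rV[R]_m) :
  (forall g, g != 0 -> 0 < dotr (K g) g) ->
  (forall g, 2 * \sum_i w i * (dotr g (v i) * dotr (K g) (v i)) <= dotr (K g) g) ->
  forall g, \sum_i w i * dotr g (v i) ^+ 2 <= dotr g g / 2.
Proof.
move=> Kpos lyap.
pose S g h := \sum_i w i * (dotr g (v i) * dotr h (v i)).
have SC g h : S g h = S h g.
  by apply: eq_bigr => i _; rewrite [X in _ * X]mulrC.
have SD g g' h : S (g + g') h = S g h + S g' h.
  by rewrite -big_split; apply: eq_bigr => i _ /=; rewrite dotrDl; ring.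
have SZ a g h : S (a *: g) h = a * S g h.
  by rewrite mulr_sumr; apply: eq_bigr => i _ /=; rewrite dotrZl; ring.
suff : forall g, S g g <= dotr g g / 2.
  by move=> H g; apply: le_trans (H g); apply: ler_sum => i _; rewrite expr2.
move=> g; have [->|g0] := eqVneq g 0.
  by rewrite -(scale0r 0) SZ mul0r divr_ge0// dotr_ge0.
pose A := [set h : 'rV[R]_m | dotr h h = 1].
have nz h : h != 0 -> A ((Num.sqrt (dotr h h))^-1 *: h).
  move=> h0; rewrite /A /= dotrZl dotrC dotrZl mulrA -invfM -expr2 sqr_sqrtr ?dotr_ge0//.
  by rewrite mulVf// gt_eqF// dotr_gt0.
have Scont : continuous (fun h => S h h).
  rewrite /S; apply: continuous_big => [|i _ h]; first exact: add_continuous.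
  have c := @dotr_continuous R m (v i) h.
  exact: (cvgM (cvg_cst (w i)) (cvgM c c)).
have [||h hA hmax] := @EVT_max_rV R m (fun h => S h h) A _ (@sphere_compact R m).
- by exists ((Num.sqrt (dotr g g))^-1 *: g); exact: nz.
- exact: continuous_subspaceT.
set l := S h h in hmax.
have h1 : dotr h h = 1 by move: hA; rewrite inE.
have Sle k : S k k <= l * dotr k k.
  have [->|k0] := eqVneq k 0; first by rewrite -(scale0r 0) SZ dotrZl !mul0r mulr0.
  have := hmax _ (mem_set (nz _ k0)).
  rewrite SZ SC SZ mulrA -invfM -expr2 sqr_sqrtr ?dotr_ge0//.
  by rewrite mulrC ler_pdivrMr ?dotr_gt0.
(* First-order optimality: h is an eigenvector of the second-moment form. *)
have opt k : S h k = l * dotr h k.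
  have q e : 2 * e * (S h k - l * dotr h k) + e ^+ 2 * (S k k - l * dotr k k) <= 0.
    have := Sle (h + e *: k).
    rewrite SD SZ !(SC _ (h + e *: k)) !SD !SZ (SC k h) -/l.
    rewrite dotrDl dotrZl !(dotrC _ (h + e *: k)) !dotrDl !dotrZl h1 (dotrC k h); nra.
  apply/eqP; rewrite -subr_eq0; apply/eqP.
  apply: (@quadratic_le0_linear_eq0 _ _ ((S k k - l * dotr k k) / 4)) => e.
  by have := q (e / 2); nra.
have h0 : h != 0 by rewrite -dotr_gt0 h1.
have := lyap h; rewrite -/(S h (K h)) opt dotrC mulrA.
rewrite ger_pMl ?Kpos// => l2.
apply: le_trans (Sle g) _; rewrite mulrC ler_wpM2l ?dotr_ge0//.
by rewrite -[2^-1]mul1r ler_pdivlMr// mulrC.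
Qed.

(** * Second moment of the density field *)

Definition left_site n (x : 'I_n) : 'I_n.+1 := widen_ord (leqnSn n) x.
Definition right_site n (x : 'I_n) : 'I_n.+1 := lift ord0 x.

Definition boundary_rate (R : realType) (c theta : R) n : R := c * n.+2%:R `^ (- theta).

Definition dirichlet (R : realType) n (k : R) (g h : 'rV[R]_n.+1) : R :=
  \sum_(x < n) (g 0 (right_site x) - g 0 (left_site x))
             * (h 0 (right_site x) - h 0 (left_site x))
  + k * (g 0 ord0 * h 0 ord0) + k * (g 0 ord_max * h 0 ord_max).

Definition dirichlet_op (R : realType) n (k : R) (g : 'rV[R]_n.+1) : 'rV[R]_n.+1 :=
  \row_z dirichlet k g (delta_mx 0 z).

Lemma dotr_dirichlet_op (R : realType) n (k : R) (g h : 'rV[R]_n.+1) :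
  dotr (dirichlet_op k g) h = dirichlet k g h.
Proof.
have pick (y : 'I_n.+1) : \sum_z (delta_mx 0 z : 'rV[R]_n.+1) 0 y * h 0 z = h 0 y.
  rewrite (bigD1 y)//= mxE !eqxx mul1r big1 ?addr0// => z zy.
  by rewrite mxE eqxx /= eq_sym (negbTE zy) mul0r.
rewrite /dotr; under eq_bigr do rewrite mxE /dirichlet !mulrDl mulr_suml.
rewrite !big_split /= exchange_big /=; congr (_ + _ + _).
- apply: eq_bigr => x _.
  rewrite -(pick (right_site x)) -(pick (left_site x)) -sumrB mulr_sumr.
  by apply: eq_bigr => z _; rewrite -mulrBl mulrA.
- rewrite -[in RHS](pick ord0) 2!mulr_sumr.
  by apply: eq_bigr => z _; rewrite !mulrA.
- rewrite -[in RHS](pick ord_max) 2!mulr_sumr.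
  by apply: eq_bigr => z _; rewrite !mulrA.
Qed.

Lemma dirichlet_gt0 (R : realType) n (k : R) (g : 'rV[R]_n.+1) :
  0 < k -> g != 0 -> 0 < dirichlet k g g.
Proof.
move=> k0; apply: contra_neqT; rewrite -leNgt => D0.
have b0 : 0 <= \sum_(x < n) (g 0 (right_site x) - g 0 (left_site x)) ^+ 2.
  by apply: sumr_ge0 => x _; exact: sqr_ge0.
have z0 : 0 <= k * g 0 ord0 ^+ 2 by rewrite mulr_ge0 ?sqr_ge0// ltW.
have zn : 0 <= k * g 0 ord_max ^+ 2 by rewrite mulr_ge0 ?sqr_ge0// ltW.
move: D0; rewrite /dirichlet; under eq_bigr do rewrite -expr2.
rewrite -!expr2 => D0.
have g0 : g 0 ord0 = 0.
  have /eqP : k * g 0 ord0 ^+ 2 = 0 by lra.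
  by rewrite mulf_eq0 gt_eqF//= sqrf_eq0 => /eqP.
have /psumr_eq0P gx : \sum_(x < n) (g 0 (right_site x) - g 0 (left_site x)) ^+ 2 = 0 by lra.
have step (x : 'I_n) : g 0 (right_site x) = g 0 (left_site x).
  have /(_ x isT)/eqP := gx (fun x _ => sqr_ge0 _).
  by rewrite sqrf_eq0 subr_eq0 => /eqP.
apply/rowP => -[i ilt]; rewrite mxE; elim: i ilt => [|i IH] ilt.
  by rewrite -[RHS]g0; congr (g _ _); apply: val_inj.
have := step (Ordinal (ilt : (i < n)%N)).
rewrite (_ : left_site _ = Ordinal (ltnW ilt)); last exact: val_inj.
by rewrite IH => <-; congr (g _ _); apply: val_inj.
Qed.

Definition centered (R : realType) n (r : 'rV[R]_n.+1) (eta : config n) : 'rV[R]_n.+1 :=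
  \row_x (occ R eta x - r 0 x).

Lemma dotr_centered_exchange (R : realType) n (r g : 'rV[R]_n.+1) eta (x y : 'I_n.+1) :
  x != y ->
  dotr g (centered r (exchange eta x y)) - dotr g (centered r eta)
  = (g 0 x - g 0 y) * (occ R eta y - occ R eta x).
Proof.
move=> xy; rewrite /dotr -sumrB (bigD1 x)//= (bigD1 y) 1?eq_sym//=.
rewrite big1 => [|z /andP[zx zy]]; rewrite !mxE /occ /exchange ffunE.
  by rewrite tpermL ffunE tpermR; ring.
by rewrite tpermD 1?eq_sym// subrr.
Qed.

Lemma dotr_centered_flip (R : realType) n (r g : 'rV[R]_n.+1) eta (x : 'I_n.+1) :
  dotr g (centered r (flip eta x)) - dotr g (centered r eta)
  = g 0 x * (1 - 2 * occ R eta x).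
Proof.
rewrite /dotr -sumrB (bigD1 x)//= big1 => [|z zx]; rewrite !mxE /occ /flip ffunE.
  by rewrite eqxx; case: (eta x) => /=; ring.
by rewrite (negbTE zx) subrr.
Qed.

Lemma left_right_site_neq n (x : 'I_n) : left_site x != right_site x.
Proof. by rewrite -val_eqE /= neq_ltn /bump leq0n add1n leqnn. Qed.

Section second_moment.
Variables (R : realType) (n : nat) (alpha beta c theta a : R) (r : 'rV[R]_n.+1).
Let k := boundary_rate c theta n.
Hypotheses (k_ge0 : 0 <= k) (alpha01 : 0 <= alpha <= 1) (beta01 : 0 <= beta <= 1).
Hypothesis r_affine : forall x : 'I_n, r 0 (right_site x) - r 0 (left_site x) = a.
Hypothesis r_left : k * (r 0 ord0 - alpha) = a.
Hypothesis r_right : k * (beta - r 0 ord_max) = a.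
Variable g : 'rV[R]_n.+1.
Let F eta := dotr g (centered r eta).

Lemma generator_linear eta :
  generator alpha beta c theta F eta = - dirichlet k g (centered r eta).
Proof.
rewrite /generator /bulk_generator /boundary_generator -/k.
under eq_bigr => x _ do rewrite /F dotr_centered_exchange ?left_right_site_neq//.
rewrite /F !dotr_centered_flip /dirichlet.
have rate b (x : 'I_n.+1) : k * reservoir_rate b eta x * (g 0 x * (1 - 2 * occ R eta x))
    = g 0 x * (k * (b - occ R eta x)).
  by rewrite /reservoir_rate /occ; case: (eta x) => /=; ring.
rewrite !rate.
have tel : \sum_(x < n) (g 0 (right_site x) - g 0 (left_site x)) = g 0 ord_max - g 0 ord0.
  have := @telescope_sumr _ 0 n (fun i => g 0 (inord i)) (leq0n n).
  rewrite big_mkord (_ : inord n = ord_max); last by apply: val_inj; rewrite /= inordK.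
  rewrite (_ : inord 0 = ord0); last by apply: val_inj; rewrite /= inordK.
  move=> <-; apply: eq_bigr => x _.
  rewrite (_ : right_site x = inord x.+1); last by apply: val_inj; rewrite /= inordK// ltnS.
  by rewrite (_ : left_site x = inord x)//; apply: val_inj; rewrite /= inordK// ltnS ltnW.
have -> : \sum_(x < n) (g 0 (right_site x) - g 0 (left_site x)) *
      (centered r eta 0 (right_site x) - centered r eta 0 (left_site x)) =
    \sum_(x < n) (g 0 (right_site x) - g 0 (left_site x)) *
      (occ R eta (right_site x) - occ R eta (left_site x)) -
    a * (g 0 ord_max - g 0 ord0).
  rewrite -tel mulr_sumr -sumrB; apply: eq_bigr => x _.
  by rewrite -(r_affine x) !mxE; ring.
set s := \sum_(x < n) _ * _.
rewrite (_ : \sum_(x < n) _ = - s); last first.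
  by rewrite -sumrN; apply: eq_bigr => x _; rewrite -/(left_site x) -/(right_site x); ring.
rewrite !mxE.
have -> : k * (alpha - occ R eta ord0) = k * (r 0 ord0 - occ R eta ord0) - a.
  by rewrite -r_left; ring.
have -> : k * (beta - occ R eta ord_max) = k * (r 0 ord_max - occ R eta ord_max) + a.
  by rewrite -r_right; ring.
by ring.
Qed.

Lemma generator_square_le eta :
  generator alpha beta c theta (fun eta => F eta ^+ 2) eta
  <= - 2 * (F eta * dirichlet k g (centered r eta)) + dirichlet k g g.
Proof.
rewrite mulrA -[leRHS](_ : 2 * F eta * generator alpha beta c theta F eta + dirichlet k g g = _).
  2: by rewrite generator_linear; ring.
have sq u v : u ^+ 2 - v ^+ 2 = 2 * v * (u - v) + (u - v) ^+ 2 :> R by ring.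
have rate_le b (x : 'I_n.+1) : 0 <= b <= 1 ->
    boundary_generator b c theta x (fun eta => F eta ^+ 2) eta <=
    2 * F eta * boundary_generator b c theta x F eta + k * (g 0 x * g 0 x).
  move=> b01; rewrite /boundary_generator -/k sq mulrDr mulrCA lerD2l.
  rewrite /F dotr_centered_flip -[leLHS]mulrA ler_wpM2l// /reservoir_rate /occ.
  have := sqr_ge0 (g 0 x); case: (eta x) => /=; nra.
have bulk_le : bulk_generator (fun eta => F eta ^+ 2) eta <=
    2 * F eta * bulk_generator F eta +
    \sum_(x < n) (g 0 (right_site x) - g 0 (left_site x))
             * (g 0 (right_site x) - g 0 (left_site x)).
  rewrite /bulk_generator mulr_sumr -big_split ler_sum// => x _ /=.
  rewrite sq lerD2l /F dotr_centered_exchange ?left_right_site_neq//.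
  rewrite exprMn -expr2 -sqrrN opprB ler_piMr ?sqr_ge0// /occ.
  by do 2 case: (eta _) => /=; rewrite ?subrr ?sub0r ?subr0 ?sqrrN ?expr1n ?expr0n.
have := rate_le _ ord0 alpha01; have := rate_le _ ord_max beta01; move: bulk_le.
rewrite /generator /dirichlet; lra.
Qed.

End second_moment.

(* The interpolation parameter [t] of the discrete stationary profile
   [alpha + (beta - alpha) (u + (1 - 2 u) t)], whose limit determines [rho]. *)
Definition profile_param (R : realType) (c theta : R) n : R :=
  (1 - boundary_rate c theta n) / (2 + boundary_rate c theta n * n%:R).

Definition profile (R : realType) (alpha beta t u : R) : R :=
  alpha + (beta - alpha) * (u + (1 - 2 * u) * t).

Definition discrete_profile (R : realType) (alpha beta c theta : R) n : 'rV[R]_n.+1 :=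
  \row_x profile alpha beta (profile_param c theta n) (x.+1%:R / n.+2%:R).

Lemma boundary_rate_gt0 (R : realType) (c theta : R) n : 0 < c -> 0 < boundary_rate c theta n.
Proof. by move=> c0; rewrite mulr_gt0// powR_gt0. Qed.

Lemma second_moment_le (R : realType) n (alpha beta c theta : R)
    (mu : probability (config n) R) (g : 'rV[R]_n.+1) :
  0 <= alpha <= 1 -> 0 <= beta <= 1 -> 0 < c -> stationary alpha beta c theta mu ->
  \sum_eta weight mu eta * dotr g (centered (discrete_profile alpha beta c theta n) eta) ^+ 2
  <= dotr g g / 2.
Proof.
move=> a01 b01 c0 st; set r := discrete_profile _ _ _ _ _.
set k := boundary_rate c theta n.
have k0 : 0 < k by exact: boundary_rate_gt0.
have n0 : 0 <= n%:R :> R by [].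
have D0 : 2 + k * n%:R != 0 by rewrite gt_eqF// ltr_pwDl// mulr_ge0// ltW.
have N0 : n.+2%:R != 0 :> R by rewrite pnatr_eq0.
have N2 : n.+2%:R = n%:R + 2 :> R by rewrite -addn2 natrD.
pose a := k * (beta - alpha) / (2 + k * n%:R).
apply: (@Lyapunov_comparison _ _ _ (weight mu) (centered r) (dirichlet_op k)).
  by move=> h h0; rewrite dotr_dirichlet_op dirichlet_gt0.
move=> h; rewrite dotr_dirichlet_op.
have mass : \sum_eta weight mu eta = 1.
  have := measure_weight mu setT; rewrite probability_setT => -[->].
  by apply: eq_bigr => eta _; rewrite indicT mulr1.
have := stationary_mean_generator (fun eta => dotr h (centered r eta) ^+ 2) st.
have le := @generator_square_le R n alpha beta c theta a r (ltW k0) a01 b01 _ _ _ h.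
have {}le eta := le _ _ _ eta.
move=> E0.
have : 0 <= \sum_eta weight mu eta * (- 2 * (dotr h (centered r eta)
     * dirichlet k h (centered r eta)) + dirichlet k h h).
  rewrite -[leLHS]E0; apply: ler_sum => eta _; apply: ler_wpM2l; first exact: weight_ge0.
  apply: le.
  - move=> x; rewrite !mxE /profile /profile_param -/k /= /bump leq0n add1n.
    rewrite -[x.+2%:R]natr1 N2 /a; field.
    by rewrite D0 -N2 N0.
  - rewrite !mxE /profile /profile_param -/k /a N2 /=; field.
    by rewrite D0 -N2 N0.
  - rewrite !mxE /profile /profile_param -/k /a N2 -natr1 /=; field.
    by rewrite D0 -N2 N0.
under eq_bigr do rewrite mulrDr mulrCA dotrC.
rewrite big_split /= -mulr_sumr -mulr_suml mass mul1r.
under [in X in _ -> X]eq_bigr do rewrite dotr_dirichlet_op.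
by under eq_bigr do rewrite dotrC; lra.
Qed.

(** * Limit of the profile and concentration *)

Lemma Chebyshev_profile (R : realType) n (alpha beta c theta d : R)
    (mu : probability (config n) R) (g : 'rV[R]_n.+1) :
  0 <= alpha <= 1 -> 0 <= beta <= 1 -> 0 < c -> stationary alpha beta c theta mu -> 0 < d ->
  (mu [set eta | (d <= `|dotr g (centered (discrete_profile alpha beta c theta n) eta)|)%R]
  <= (dotr g g / (2 * d ^+ 2))%:E)%E.
Proof.
move=> a01 b01 c0 st d0; rewrite measure_weight lee_fin.
have d20 : 0 < d ^+ 2 by rewrite exprn_gt0.
rewrite invfM mulrA ler_pdivlMr// mulr_suml.
apply: le_trans (second_moment_le g a01 b01 c0 st); apply: ler_sum => eta _.
rewrite -mulrA ler_wpM2l ?weight_ge0// indicE.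
have [|_] := boolP (eta \in _); last by rewrite mul0r sqr_ge0.
by rewrite inE /= => h; rewrite mul1r -[leRHS]real_normK ?num_real// lerXn2r ?nnegrE// ltW.
Qed.

Lemma powRN_cvg0 (R : realType) (p : R) :
  0 < p -> (fun n => n.+2%:R `^ (- p)) @ \oo --> (0 : R).
Proof.
move=> p0.
have /cvg_at_rightP/(_ (fun n => n.+2%:R^-1)) := powR_cvg0 p0.
have h : (fun n => n.+2%:R^-1 : R) @ \oo --> (0 : R).
  by have := @cvg_harmonic R; rewrite -cvg_shiftS; exact.
have inv_gt0 n : 0 < n.+2%:R^-1 :> R by rewrite invr_gt0.
move=> /(_ (conj inv_gt0 h)).
by under eq_cvg do rewrite -powR_inv1// -powRrM mulN1r.
Qed.

Definition profile_param_limit (R : realType) (c theta : R) : R :=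
  if theta < 1 then 0 else if theta == 1 then (2 + c)^-1 else 2^-1.

Lemma rho_profile (R : realType) (alpha beta c theta u : R) : 0 < c ->
  rho alpha beta c theta u = profile alpha beta (profile_param_limit c theta) u.
Proof.
move=> c0; rewrite /rho /profile /profile_param_limit.
case: ifP => _; first by ring.
have c2 : 2 + c != 0 by rewrite gt_eqF// addr_gt0.
by case: ifP => _; field.
Qed.

Lemma boundary_rate_cvg0 (R : realType) (c theta : R) : 0 < theta ->
  boundary_rate c theta n @[n --> \oo] --> 0.
Proof.
move=> t0; rewrite -(mulr0 c); apply: cvgM; [exact: cvg_cst|exact: powRN_cvg0].
Qed.

Lemma profile_param_cvg (R : realType) (c theta : R) : 0 < c -> 0 <= theta ->
  profile_param c theta n @[n --> \oo] --> profile_param_limit c theta.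
Proof.
move=> c0 t0; rewrite /profile_param_limit.
have c2 : 2 + c != 0 by rewrite gt_eqF// addr_gt0.
have N0 n : n.+2%:R != 0 :> R by rewrite pnatr_eq0.
have DE n : 2 + boundary_rate c theta n * n%:R
    = 2 * (1 - boundary_rate c theta n) + c * n.+2%:R `^ (1 - theta).
  rewrite powRD ?N0 ?implybT// powRr1// /boundary_rate -(addn2 n) natrD; ring.
have D0 n : 2 + boundary_rate c theta n * n%:R != 0.
  by rewrite gt_eqF// ltr_pwDl// mulr_ge0// ltW// boundary_rate_gt0.
have k1 : 0 < theta -> 1 - boundary_rate c theta n @[n --> \oo] --> (1 - 0 : R).
  by move=> tp; apply: cvgB; [exact: cvg_cst|exact: boundary_rate_cvg0].
rewrite /profile_param; under eq_cvg do rewrite DE.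
case: ltgtP => [t1|t1|t1].
- have [k kc] : exists k : R, boundary_rate c theta n @[n --> \oo] --> k.
    have [->|tn0] := eqVneq theta 0.
      exists c; apply: cvg_near_cst; near=> n.
      by rewrite /boundary_rate oppr0 powRr0 mulr1.
    by exists 0; apply: boundary_rate_cvg0; rewrite lt_def tn0.
  have nu := @powRN_cvg0 R (1 - theta); rewrite subr_gt0 in nu; have {}nu := nu t1.
  have : (fun n : nat => (1 - boundary_rate c theta n) * n.+2%:R `^ (- (1 - theta)) /
     (2 * (1 - boundary_rate c theta n) * n.+2%:R `^ (- (1 - theta)) + c)) @ \oo -->
     (1 - k) * 0 / (2 * (1 - k) * 0 + c).
    have kc1 : 1 - boundary_rate c theta n @[n --> \oo] --> (1 - k : R).
      by apply: cvgB => //; exact: cvg_cst.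
    apply: cvgM; first exact: cvgM.
    apply: cvgV; first by rewrite mulr0 add0r gt_eqF.
    apply: cvgD; last exact: cvg_cst.
    by apply: cvgM => //; apply: cvgM => //; exact: cvg_cst.
  rewrite mulr0 mul0r.
  apply: cvg_trans; apply: near_eq_cvg; near=> n.
  have P0 : n.+2%:R `^ (1 - theta) != 0 by rewrite gt_eqF// powR_gt0.
  have := D0 n; rewrite DE powRN.
  by move: P0; generalize (n.+2%:R `^ (1 - theta)) => P P0 DP; field; rewrite P0 DP.
- have : (fun n => 2 * (1 - boundary_rate c theta n) + c * n.+2%:R `^ (1 - theta)) @ \oo
      --> 2 * (1 - 0) + c * 0.
    apply: cvgD; apply: cvgM; [exact: cvg_cst|by apply: k1; lra|exact: cvg_cst|].
    by rewrite -opprB; apply: powRN_cvg0; rewrite subr_gt0.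
  rewrite mulr0 addr0 subr0 mulr1 => D2.
  by rewrite -[2^-1]mul1r -[in X in X * _](subr0 1); apply: cvgM; [by apply: k1; lra|exact: cvgV].
- have D2 : (fun n => 2 * (1 - boundary_rate c theta n) + c * n.+2%:R `^ (1 - theta)) @ \oo
      --> 2 * (1 - 0) + c * 1.
    apply: cvgD; apply: cvgM; [exact: cvg_cst|by apply: k1; lra|exact: cvg_cst|].
    apply: cvg_near_cst; near=> n; by rewrite t1 subrr powRr0.
  rewrite subr0 !mulr1 in D2.
  by rewrite -[(2 + c)^-1]mul1r -[in X in X * _](subr0 1); apply: cvgM; [by apply: k1; lra|exact: cvgV].
Unshelve. all: by end_near. Qed.

Lemma mean_cvg (R : realType) (alpha beta c theta : R) (H : R -> R) :
  0 < c -> 0 <= theta -> {within `[0, 1], continuous H} ->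
  (fun n => dotr (\row_(x < n.+1) (n.+1%:R^-1 * H (x.+1%:R / n.+2%:R)))
                 (discrete_profile alpha beta c theta n)) @ \oo -->
  \int[lebesgue_measure]_(u in `[0, 1]) (H u * rho alpha beta c theta u).
Proof.
move=> c0 t0 Hc; set t := profile_param_limit c theta.
have affine_continuous (p q : R) : {within `[0, 1], continuous (fun u => H u * (p * u + q))}.
  move=> x; apply: cvgM; first exact: Hc.
  apply: (@continuous_subspaceT _ _ _ (fun u : R => p * u + q)) => y.
  by apply: cvgD; [apply: cvgM; [exact: cvg_cst|exact: cvg_id]|exact: cvg_cst].
pose P (u : R) := H u * profile alpha beta t u.
pose Q (u : R) := H u * ((beta - alpha) * (1 - 2 * u)).
have Pc : {within `[0, 1], continuous P}.
  rewrite (_ : P = fun u => H u * ((beta - alpha) * (1 - 2 * t) * u +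
    (alpha + (beta - alpha) * t))) //.
  by apply/funext => u; rewrite /P /profile; ring.
have Qc : {within `[0, 1], continuous Q}.
  rewrite (_ : Q = fun u => H u * (- 2 * (beta - alpha) * u + (beta - alpha))) //.
  by apply/funext => u; rewrite /Q; ring.
rewrite (_ : (fun u => _) = P); last by apply/funext => u; rewrite /P rho_profile.
set I := \int[_]_(_ in _) P _.
have : (fun n => n.+1%:R^-1 * (\sum_(i < n.+1) P (i.+1%:R / n.+2%:R)) +
   (profile_param c theta n - t) *
     (n.+1%:R^-1 * (\sum_(i < n.+1) Q (i.+1%:R / n.+2%:R)))) @ \oo -->
  I + (t - t) * \int[lebesgue_measure]_(u in `[0, 1]) Q u.
  apply: cvgD; first exact: Riemann_sum_interior_cvg.
  apply: cvgM; last exact: Riemann_sum_interior_cvg.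
  by apply: cvgB; [exact: profile_param_cvg|exact: cvg_cst].
rewrite subrr mul0r addr0.
apply: cvg_trans; apply: near_eq_cvg; near=> n.
rewrite /dotr !mulr_sumr -big_split; apply: eq_bigr => i _ /=.
by rewrite !mxE /P /Q /profile; ring.
Unshelve. all: by end_near. Qed.

Lemma empirical_average_dotr (R : realType) n (H : R -> R) (r : 'rV[R]_n.+1) (eta : config n) :
  let g := \row_(x < n.+1) (n.+1%:R^-1 * H (x.+1%:R / n.+2%:R)) in
  empirical_average H eta = dotr g (centered r eta) + dotr g r.
Proof.
rewrite /= /empirical_average mulr_sumr /dotr -big_split; apply: eq_bigr => x _ /=.
by rewrite !mxE; ring.
Qed.

Lemma dotr_empirical_le (R : realType) n (H : R -> R) (M : R) :
  (forall u, u \in `[0, 1] -> `|H u| <= M) ->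
  let g := \row_(x < n.+1) (n.+1%:R^-1 * H (x.+1%:R / n.+2%:R)) in
  dotr g g <= M ^+ 2 * n.+1%:R^-1.
Proof.
move=> HM /=; have N0 : 0 < n.+1%:R :> R by [].
rewrite (_ : M ^+ 2 * n.+1%:R^-1 = \sum_(x < n.+1) n.+1%:R^-1 ^+ 2 * M ^+ 2).
  apply: ler_sum => x _; rewrite !mxE -expr2 exprMn ler_wpM2l ?sqr_ge0//.
  have h : `|H (x.+1%:R / n.+2%:R)| <= M.
    apply: HM; rewrite in_itv /= divr_ge0//= ler_pdivrMr// mul1r ler_nat ltnW// ltnS.
    exact: ltn_ord.
  by rewrite -[leLHS]real_normK ?num_real// lerXn2r ?nnegrE// (le_trans _ h).
rewrite sumr_const card_ord -[RHS]mulr_natr; field.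
by rewrite nat1r pnatr_eq0.
Qed.

Theorem theorem2p2 (R : realType) (alpha beta c theta : R)
    (mu : forall n : nat, probability (config n) R)
    (alpha01 : 0 < alpha < 1) (beta01 : 0 < beta < 1)
    (c_gt0 : 0 < c) (theta_ge0 : 0 <= theta)
    (mu_stationary : forall n : nat, stationary alpha beta c theta (mu n))
    (delta : R) (delta_gt0 : 0 < delta)
    (H : R -> R) (H_continuous : {within `[0, 1], continuous H}) :
  (fun n : nat =>
     mu n [set eta : config n |
       delta <= `| empirical_average H eta
                   - \int[lebesgue_measure]_(u in `[0, 1])
                       (H u * rho alpha beta c theta u) | ])
    @ \oo --> 0%E.
Proof.
have a01 : 0 <= alpha <= 1 by case/andP: alpha01 => ? ?; rewrite !ltW.
have b01 : 0 <= beta <= 1 by case/andP: beta01 => ? ?; rewrite !ltW.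
have [M HM] : exists M : R, forall u, u \in `[0, 1] -> `|H u| <= M.
  have [p _ pmax] := EVT_max ler01 H_continuous.
  have [q _ qmin] := EVT_min ler01 H_continuous.
  exists (`|H p| + `|H q|) => u u01; have := pmax u u01; have := qmin u u01.
  have := ler_norm (H p); have := ler_norm (- H q); rewrite normrN.
  have := normr_ge0 (H p); have := normr_ge0 (H q).
  by rewrite ler_norml => *; apply/andP; split; lra.
set I := \int[_]_(_ in _) _.
have d20 : 0 < delta / 2 by rewrite divr_gt0.
pose B n : R := M ^+ 2 / (2 * (delta / 2) ^+ 2) * n.+1%:R^-1.
apply: (@squeeze_cvge _ _ _ _ (fun=> 0%E) _ (fun n => (B n)%:E)); last 2 first.
- exact: cvg_cst.
- apply: cvg_EFin; first by near=> n.
  have : B @ \oo --> M ^+ 2 / (2 * (delta / 2) ^+ 2) * 0.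
    by apply: cvgM; [exact: cvg_cst|exact: (@cvg_harmonic R)].
  by rewrite mulr0.
have /cvgrPdist_lt/(_ _ d20) := @mean_cvg R alpha beta c theta H c_gt0 theta_ge0 H_continuous.
rewrite -/I => mean_near; near=> n; rewrite measure_ge0 /=.
have mean : `|I - dotr (\row_(x < n.+1) (n.+1%:R^-1 * H (x.+1%:R / n.+2%:R)))
    (discrete_profile alpha beta c theta n)| < delta / 2 by near: n.
set g := \row_x _ in mean *.
apply: (@le_trans _ _ (mu n [set eta | (delta / 2 <=
    `|dotr g (centered (discrete_profile alpha beta c theta n) eta)|)%R])).
  apply: le_measure; rewrite ?inE//= => eta /=.
  rewrite (empirical_average_dotr H (discrete_profile alpha beta c theta n)) -/g.
  set X := dotr g (centered _ _); set m := dotr g _ in mean * => h.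
  have : `|X + m - I| <= `|X| + `|I - m|.
    by rewrite -addrA (le_trans (ler_normD _ _))// [`|m - I|]distrC.
  lra.
apply: le_trans (Chebyshev_profile g a01 b01 c_gt0 (mu_stationary n) d20) _.
rewrite lee_fin /B mulrAC ler_wpM2r//; first by rewrite invr_ge0 mulr_ge0// sqr_ge0.
exact: dotr_empirical_le.
Unshelve. all: by end_near. Qed.
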